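(* Let $(X,\tau)$ be a topological metrizable space. Then $$\upsilon X=\bigvee\big\{H(U_d(X)): d\text{ is a metric on }X\text{ with }\tau_d=\tau\big\},$$ where $\tau_d$ denotes the topology induced by $d$.
   Context: A realcompactification of $X$ is a realcompact Tychonoff space containing $X$ as a dense subspace. $\alpha_1X\le\alpha_2X$ means that there is a continuous map $\alpha_2X\to\alpha_1X$ leaving $X$ pointwise fixed; $\alpha_1X$ and $\alpha_2X$ are equivalent if $\alpha_1X\le\alpha_2X\le\alpha_1X$. Realcompactifications are considered up to equivalence, and $\bigvee$ is the supremum for this order. $\upsilon X$ is the Hewitt-Nachbin realcompactification of $X$: the (unique up to equivalence) smallest realcompactification of $X$ to which every continuous function $X\to\mathbb{R}$ extends continuously (with real values). For a metric $d$ on $X$ inducing $\tau$, $U_d(X)$ is the unital vector lattice of all real-valued $d$-uniformly continuous functions on $X$, and the Samuel realcompactification $H(U_d(X))$ is the space of unital vector lattice homomorphisms $U_d(X)\to\mathbb{R}$ with the topology of pointwise convergence ($X$ embedded via evaluations); equivalently, it is the smallest realcompactification of $X$ to which every $f\in U_d(X)$ extends to a continuous real-valued function. *)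

(* Defs.v *)
From HB Require Import structures.
From mathcomp Require Import all_boot all_order all_algebra.
From mathcomp Require Import all_classical all_reals all_analysis.
From mathcomp Require Import lra.

Set Implicit Arguments.
Unset Strict Implicit.
Unset Printing Implicit Defensive.

Import Order.TTheory GRing.Theory Num.Theory.
Import numFieldNormedType.Exports.

Local Open Scope classical_set_scope.
Local Open Scope ring_scope.

Section Metric.
Context {R : realType} {X : topologicalType}.

Definition is_metric (d : X -> X -> R) : Prop :=
  [/\ forall x y, 0 <= d x y,
      forall x y, d x y = 0 <-> x = y,
      forall x y, d x y = d y x &
      forall x y z, d x z <= d x y + d y z].

Definition induces_topology (d : X -> X -> R) : Prop :=
  forall U : set X, open U <->
    forall x, U x -> exists2 e : R, 0 < e & [set y | d x y < e] `<=` U.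

Definition compatible_metric (d : X -> X -> R) : Prop :=
  is_metric d /\ induces_topology d.

(* U_d(X) *)
Definition unif_cont (d : X -> X -> R) : set (X -> R) :=
  [set f | forall e : R, 0 < e -> exists2 del : R, 0 < del &
    forall x y, d x y < del -> `|f x - f y| < e].

End Metric.

Definition metrizable (R : realType) (X : topologicalType) : Prop :=
  exists d : X -> X -> R, compatible_metric d.

Section Lattice.
Context {R : realType} {X : Type}.

Definition unital_vector_lattice (L : set (X -> R)) : Prop :=
  [/\ L (cst 1),
      forall f g, L f -> L g -> L (f \+ g),
      forall (a : R) f, L f -> L (fun x => a * f x),
      forall f g, L f -> L g -> L (f \max g) &
      forall f g, L f -> L g -> L (f \min g)].

(* The operations of L are those of X -> R; stating preservation for every h
   in L equal to the result avoids carrying closure proofs, and means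
   preservation of all the operations as soon as L is a unital vector lattice
   (see unif_cont_lattice below). *)
Definition lattice_hom (L : set (X -> R)) (phi : L -> R) : Prop :=
  [/\ forall h : L, set_val h = cst 1 -> phi h = 1,
      forall f g h : L, set_val h = set_val f \+ set_val g ->
        phi h = phi f + phi g,
      forall (a : R) (f h : L), set_val h = (fun x => a * set_val f x) ->
        phi h = a * phi f,
      forall f g h : L, set_val h = set_val f \max set_val g ->
        phi h = Num.max (phi f) (phi g) &
      forall f g h : L, set_val h = set_val f \min set_val g ->
        phi h = Num.min (phi f) (phi g)].

(* H(L), with the topology of pointwise convergence *)
Definition hom_space (L : set (X -> R)) : topologicalType :=
  [set phi : {ptws L -> R} | lattice_hom phi].

Lemma eval_lattice_hom (L : set (X -> R)) (x : X) :
  @lattice_hom L (fun f => set_val f x).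
Proof.
by split=> [h ->|f g h ->|a f h ->|f g h ->|f g h ->].
Qed.

Definition hom_eval (L : set (X -> R)) (x : X) : hom_space L :=
  exist _ (fun f : L => set_val f x) (mem_set (eval_lattice_hom L x)).

End Lattice.

Lemma unif_cont_lattice (R : realType) (X : topologicalType)
  (d : X -> X -> R) : unital_vector_lattice (unif_cont d).
Proof.
split.
- by move=> e e0; exists 1 => // x y _; rewrite /cst /= subrr normr0.
- move=> f g Lf Lg e e0; have e2 : 0 < e / 2 by rewrite divr_gt0.
  have [r r0 fr] := Lf _ e2; have [s s0 gs] := Lg _ e2.
  exists (Num.min r s); first by rewrite lt_min r0.
  move=> x y; rewrite lt_min => /andP[/fr fxy /gs gxy] /=.
  rewrite opprD addrACA (splitr e).
  by apply: (le_lt_trans (ler_normD _ _)); apply: ltrD.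
- move=> a f Lf e e0.
  have a1 : 0 < `|a| + 1 by rewrite ltr_wpDl.
  have [r r0 fr] := Lf _ (divr_gt0 e0 a1); exists r => // x y /fr.
  rewrite ltr_pdivlMr//; apply: le_lt_trans.
  by rewrite -mulrBr normrM [leRHS]mulrC ler_wpM2r// lerDl.
- move=> f g Lf Lg e e0; have [r r0 fr] := Lf _ e0; have [s s0 gs] := Lg _ e0.
  exists (Num.min r s); first by rewrite lt_min r0.
  move=> x y; rewrite lt_min => /andP[/fr + /gs] /=.
  rewrite !ltr_norml => /andP[? ?] /andP[? ?].
  by case: (leP (f x) (g x)); case: (leP (f y) (g y)); lra.
- move=> f g Lf Lg e e0; have [r r0 fr] := Lf _ e0; have [s s0 gs] := Lg _ e0.
  exists (Num.min r s); first by rewrite lt_min r0.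
  move=> x y; rewrite lt_min => /andP[/fr + /gs] /=.
  rewrite !ltr_norml => /andP[? ?] /andP[? ?].
  by case: (leP (f x) (g x)); case: (leP (f y) (g y)); lra.
Qed.

Definition topological_embedding (S T : topologicalType) (f : S -> T) : Prop :=
  [/\ injective f, continuous f &
      forall U : set S, open U ->
        exists2 V : set T, open V & f @` U = V `&` range f].

(* Homeomorphic to a closed subspace of a power of the real line; such a space
   is automatically Tychonoff. *)
Definition realcompact (R : realType) (Y : topologicalType) : Prop :=
  exists (I : Type) (f : Y -> {ptws I -> R}),
    topological_embedding f /\ closed (range f).

Record extension (X : topologicalType) := Extension {
  ext_space :> topologicalType;
  ext_map : X -> ext_space }.

Section Realcompactification.
Context (R : realType) (X : topologicalType).
Implicit Types A B : extension X.

Definition realcompactification A : Prop :=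
  [/\ realcompact R A, topological_embedding (ext_map A) &
      dense (range (ext_map A))].

Definition ext_le A B : Prop :=
  exists2 h : B -> A, continuous h & forall x, h (ext_map B x) = ext_map A x.

Definition is_supremum (F : extension X -> Prop) A : Prop :=
  [/\ realcompactification A,
      forall B, F B -> ext_le B A &
      forall B, realcompactification B ->
        (forall B', F B' -> ext_le B' B) -> ext_le A B].

Definition extends_continuous A : Prop :=
  forall f : X -> R, continuous f ->
    exists2 g : A -> R, continuous g & forall x, g (ext_map A x) = f x.

(* A represents the equivalence class of the Hewitt-Nachbin
   realcompactification. *)
Definition hewitt_nachbin A : Prop :=
  [/\ realcompactification A, extends_continuous A &
      forall B, realcompactification B -> extends_continuous B -> ext_le A B].

Definition samuel (d : X -> X -> R) : extension X :=
  Extension (hom_eval (unif_cont d)).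

Definition samuel_family B : Prop :=
  exists2 d : X -> X -> R, compatible_metric d & B = samuel d.

End Realcompactification.

Arguments samuel_family R X : clear implicits.

(* Main.v *)
Require Import Defs.
From mathcomp Require Import all_boot all_order all_algebra.
From mathcomp Require Import all_classical all_reals all_analysis.
From mathcomp Require Import lra.

Set Implicit Arguments.
Unset Strict Implicit.
Unset Printing Implicit Defensive.

Import Order.TTheory GRing.Theory Num.Theory.
Import numFieldNormedType.Exports.

Local Open Scope classical_set_scope.
Local Open Scope ring_scope.

(** The Hewitt-Nachbin realcompactification and the supremum of the Samuel
realcompactifications are both least elements, for the order on
realcompactifications, and the theorem holds because they are least in the same
class: a realcompactification B extends every continuous real function on X if
and only if it dominates H(U_d(X)) for every compatible metric d
([extends_continuousE]).

If B extends all continuous functions, then in particular it extends those of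
U_d(X). The extensions, taken together, send a point of B to a functional on
U_d(X), and this functional is a lattice homomorphism because it satisfies the
required identities on the dense subset X ([ext_le_hom_space]).

Conversely, every continuous f is uniformly continuous for some compatible
metric, namely d(x, y) + |f x - f y| where d is any compatible metric
([compatible_metric_plus]). Evaluation at f extends f to the Samuel
realcompactification of that metric, and this extension pulls back to any B
that dominates it.

That a least element exists is seen on the closure of the image of X in the
power of the real line indexed by the continuous functions on X
([hewitt_nachbin_hewitt]). *)

(** * Compatible metrics and uniformly continuous functions *)

Section CompatibleMetrics.
Context {R : realType} {X : topologicalType}.
Implicit Types (d : X -> X -> R) (f : X -> R).

Lemma nbhs_compatible_metric d (x : X) (P : set X) : compatible_metric d ->
  nbhs x P <-> exists2 e : R, 0 < e & [set y | d x y < e] `<=` P.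
Proof.
move=> [[d0 deq dC dtri] dtop]; split.
  rewrite nbhsE => -[U [oU Ux] UP].
  have [e e0 eU] := (dtop U).1 oU x Ux.
  by exists e => //; apply: subset_trans UP.
move=> [e e0 eP]; rewrite nbhsE; exists [set y | d x y < e] => //; split.
  apply/(dtop _).2 => y /= dxy; exists (e - d x y); first by rewrite subr_gt0.
  by move=> z /= dyz; apply: (le_lt_trans (dtri x y z)); rewrite -ltrBrDl.
by rewrite /= (deq x x).2.
Qed.

Lemma unif_cont_continuous d f :
  compatible_metric d -> unif_cont d f -> continuous f.
Proof.
move=> dX fd x; apply/cvgrPdist_lt => e e0.
have [r r0 fr] := fd e e0; apply/(nbhs_compatible_metric _ _ dX).
by exists r => // y /= /fr.
Qed.

Lemma dist_continuous d (x : X) : compatible_metric d -> continuous (d x).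
Proof.
move=> dX; have [[d0 deq dC dtri] _] := dX.
apply: (unif_cont_continuous dX) => e e0; exists e => // y z dyz.
have := dtri x y z; have := dtri x z y; rewrite (dC z y) ltr_norml => h1 h2.
by apply/andP; split; lra.
Qed.

(** The metric of the graph of f, which makes f 1-Lipschitz. *)
Definition metric_plus d f (x y : X) : R := d x y + `|f x - f y|.

(** The new metric dominates d, so its topology is at least as fine; it is no
finer because f is d-continuous. *)
Lemma compatible_metric_plus d f :
  compatible_metric d -> continuous f -> compatible_metric (metric_plus d f).
Proof.
move=> dX fc; have [[d0 deq dC dtri] dtop] := dX; rewrite /metric_plus; split.
  split=> [x y|x y|x y|x y z].
  - by rewrite addr_ge0.
  - split=> [/eqP|->]; last by rewrite subrr normr0 addr0 (deq y y).2.
    by rewrite paddr_eq0// => /andP[/eqP /deq].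
  - by rewrite dC distrC.
  - by have := dtri x y z; have := ler_distD (f y) (f x) (f z); lra.
move=> U; split=> [oU x Ux|H].
  have [e e0 eU] := (dtop U).1 oU x Ux; exists e => // y /= dxy; apply: eU => /=.
  by apply: le_lt_trans dxy; rewrite lerDl.
rewrite openE => x /H[e e0 eU]; have e2 : 0 < e / 2 by rewrite divr_gt0.
have /cvgrPdist_lt /(_ _ e2) /(nbhs_compatible_metric _ _ dX)[r r0 fr] := fc x.
apply/(nbhs_compatible_metric _ _ dX); exists (Num.min r (e / 2)).
  by rewrite lt_min r0.
move=> y /=; rewrite lt_min => /andP[/fr /= h1 h2]; apply: eU => /=.
by lra.
Qed.

Lemma unif_cont_metric_plus d f :
  (forall x y, 0 <= d x y) -> unif_cont (metric_plus d f) f.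
Proof.
move=> d0 e e0; exists e => // x y; apply: le_lt_trans.
by rewrite lerDr.
Qed.

End CompatibleMetrics.


(** * Continuity in powers of the line and in subspaces *)

Section Pointwise.
Context {R : realType}.

Lemma continuous_ptws (S : topologicalType) (I : Type) (h : S -> {ptws I -> R}) :
  (forall i, continuous (fun s => h s i)) -> continuous h.
Proof.
move=> hc s; apply/cvg_sup => i.
exact: (@continuous_comp_initial _ _ _ (fun f : I -> R => f i) h (hc i)).
Qed.

Lemma eval_ptws_continuous (I : Type) (i : I) :
  continuous (fun phi : {ptws I -> R} => phi i).
Proof.
move=> phi; have /cvg_sup/(_ i) phic : nbhs phi --> phi by apply: cvg_id.
apply: cvg_trans (@initial_continuous _ _ (fun f : I -> R => f i) phi).
exact: cvg_app phic.
Qed.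

Lemma dense_eq_continuous (X T : topologicalType) (i : X -> T) (g h : T -> R) :
  dense (range i) -> continuous g -> continuous h ->
  (forall x, g (i x) = h (i x)) -> g =1 h.
Proof.
move=> di gc hc gh t; apply/eqP; rewrite -subr_eq0; apply/negPn/negP => ght.
have oO : open ((fun s => g s - h s) @^-1` [set r | r != 0]).
  apply: open_comp; last exact: open_neq.
  by move=> s _; apply: cvgB; [exact: gc|exact: hc].
have [s [/= Os [x _ xs]]] := di _ (ex_intro _ t ght) oO.
by move: Os; rewrite -xs gh subrr eqxx.
Qed.

End Pointwise.

Section SetType.
Context {T : topologicalType} (D : set T).

Lemma continuous_set_val : continuous (set_val : D -> T).
Proof. exact: initial_continuous. Qed.

Lemma continuous_to_set_type (S : topologicalType) (h : S -> D) :
  continuous (set_val \o h) -> continuous h.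
Proof. exact: continuous_comp_initial. Qed.

End SetType.

(** Used to see that a map to a power of the line, determined by its values on a
dense copy of X, lands in the closure of the image of X. *)
Lemma dense_range_closure (S B T : topologicalType) (i : S -> B) (h : B -> T) :
  dense (range i) -> continuous h -> forall b, closure (range (h \o i)) (h b).
Proof.
move=> di hc b W /hc; rewrite nbhsE => -[V [oV Vb] VW].
have [c [/VW Wc [x _ xc]]] := di V (ex_intro _ b Vb) oV.
by exists (h (i x)); split; [exists x|rewrite xc].
Qed.

(** * Extensions to which families of functions extend *)

Section Extensions.
Context {R : realType} {X : topologicalType}.
Implicit Types (d : X -> X -> R) (L : set (X -> R)) (B : extension X).

(** Choosing an extension of each member of L gives a single map to a power of
the line. This map is the common source of the comparison maps to the Samuel
and to the Hewitt-Nachbin realcompactifications. *)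
Lemma simultaneous_extension L B :
  (forall f, L f -> exists2 g : B -> R, continuous g &
     forall x, g (ext_map B x) = f x) ->
  exists2 Phi : B -> {ptws L -> R}, continuous Phi &
    forall x f, Phi (ext_map B x) f = set_val f x.
Proof.
move=> LB; have ext (f : L) : exists g : B -> R,
    continuous g /\ forall x, g (ext_map B x) = set_val f x.
  by have [g ? ?] := LB _ (set_mem (valP f)); exists g.
have [F FP] := choice ext.
exists (fun b f => F f b); first by apply: continuous_ptws => f; exact: (FP f).1.
by move=> x f; exact: (FP f).2.
Qed.

(** Each identity defining a lattice homomorphism equates two continuous real
functions of the point b of B. Both are evaluations when b comes from X, hence
they agree on all of B by density. *)
Lemma ext_le_hom_space L B : dense (range (ext_map B)) ->
  (forall f, L f -> exists2 g : B -> R, continuous g &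
     forall x, g (ext_map B x) = f x) ->
  ext_le (Extension (@hom_eval R X L)) B.
Proof.
move=> dB /simultaneous_extension[Phi Phic PhiE].
have evc (f : L) : continuous (fun b => Phi b f).
  move=> b; apply: (@continuous_comp _ _ _ Phi (fun phi => phi f)).
    exact: Phic.
  exact: eval_ptws_continuous.
have Phi_hom b : lattice_hom (Phi b).
  split.
  - move=> h hE; apply: (dense_eq_continuous dB (evc h) (h := cst 1)).
      exact: cst_continuous.
    by move=> x; rewrite PhiE hE.
  - move=> f g h hE.
    apply: (dense_eq_continuous dB (evc h) (h := fun b => Phi b f + Phi b g)).
      by move=> c; apply: cvgD; exact: evc.
    by move=> x; rewrite !PhiE hE.
  - move=> a f h hE.
    apply: (dense_eq_continuous dB (evc h) (h := fun b => a * Phi b f)).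
      by move=> c; apply: cvgMr; exact: evc.
    by move=> x; rewrite !PhiE hE.
  - move=> f g h hE.
    apply: (dense_eq_continuous dB (evc h)
      (h := fun b => Num.max (Phi b f) (Phi b g))).
      by move=> c; apply: continuous_max; exact: evc.
    by move=> x; rewrite !PhiE hE.
  - move=> f g h hE.
    apply: (dense_eq_continuous dB (evc h)
      (h := fun b => Num.min (Phi b f) (Phi b g))).
      by move=> c; apply: continuous_min; exact: evc.
    by move=> x; rewrite !PhiE hE.
exists (fun b => exist _ (Phi b) (mem_set (Phi_hom b)) : hom_space L).
  exact: continuous_to_set_type.
by move=> x; apply: val_inj; apply/funext => f; rewrite /= PhiE.
Qed.

Lemma hom_space_eval_continuous L (f : L) :
  continuous (fun phi : hom_space L => set_val phi f).
Proof.
move=> phi.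
apply: (@continuous_comp _ _ _ (set_val : hom_space L -> _) (fun phi => phi f)).
  exact: continuous_set_val.
exact: eval_ptws_continuous.
Qed.

(** The heart of the theorem: dominating all Samuel realcompactifications is
the same as extending all continuous functions, since each of these is
uniformly continuous for a suitable compatible metric. *)
Lemma extends_continuousE B : metrizable R X -> dense (range (ext_map B)) ->
  extends_continuous R B <-> forall S, samuel_family R X S -> ext_le S B.
Proof.
move=> [d dX] dB; split=> [Bext _ [d' d'X ->]|Bub f fc].
  by apply: ext_le_hom_space => // f /(unif_cont_continuous d'X) /Bext.
have dfX := compatible_metric_plus dX fc.
have fdf : unif_cont (metric_plus d f) f.
  by apply: unif_cont_metric_plus; have [[]] := dX.
have [h hc hE] := Bub _ (ex_intro2 _ _ _ dfX erefl).
pose fL : unif_cont (metric_plus d f) := exist _ f (mem_set fdf).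
exists (fun b => set_val (h b) fL); last by move=> x; rewrite hE.
move=> b; apply: (@continuous_comp _ _ _ h
  (fun phi : hom_space (unif_cont (metric_plus d f)) => set_val phi fL)).
  exact: hc.
exact: hom_space_eval_continuous.
Qed.

Definition cont_eval (x : X) : {ptws [set f : X -> R | continuous f] -> R} :=
  fun f => set_val f x.

(** With this model, closedness in a power of the line, density of X, and the
extension property (by coordinate projections) hold by construction. *)
Definition hewitt : extension X :=
  @Extension X (closure (range cont_eval))
    (fun x => exist _ (cont_eval x)
      (mem_set (subset_closure (imageT cont_eval x)))).

(** The coordinates given by the distance functions d x already separate the
points of X and recover its topology. *)
Lemma hewitt_embedding :
  metrizable R X -> topological_embedding (ext_map hewitt).
Proof.
move=> [d dX]; have [[d0 deq dC dtri] dtop] := dX.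
pose dist x : [set f : X -> R | continuous f] :=
  exist _ (d x) (mem_set (dist_continuous (x := x) dX)).
split.
- move=> x y xy.
  have : d x x = d x y := congr1 (fun p : hewitt => set_val p (dist x)) xy.
  by rewrite (deq x x).2// => /esym /deq.
- apply: continuous_to_set_type; apply: continuous_ptws => f.
  exact: set_mem (valP f).
- move=> U oU.
  (* A pair p = (x, e) stands for a ball contained in U; the ball is cut out on X
     by the coordinate d x, and this condition makes sense on the closure. *)
  exists (\bigcup_(p in [set p : X * R | [set y | d p.1 y < p.2] `<=` U])
    (fun phi : hewitt => set_val phi (dist p.1)) @^-1` [set r | r < p.2]).
    apply: bigcup_open => p _; apply: open_comp; last exact: open_lt.
    move=> phi _; apply: (@continuous_comp _ _ _ (set_val : hewitt -> _)
      (fun phi => phi (dist p.1))); first exact: continuous_set_val.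
    exact: eval_ptws_continuous.
  apply/seteqP; split=> [_ [x Ux <-]|_ [[p pU /[swap] -[x _ <-] /pU Ux]]].
    split; last by exists x.
    have [e e0 eU] := (dtop U).1 oU x Ux.
    by exists (x, e) => //; change (d x x < e); rewrite (deq x x).2.
  by exists x => //; apply: pU; move: phip; rewrite -xE.
Qed.

Lemma hewitt_nachbin_hewitt : metrizable R X -> hewitt_nachbin R hewitt.
Proof.
move=> hX; split.
- split; last 2 first.
  + exact: hewitt_embedding.
  + move=> O [phi Ophi] [W oW WO]; rewrite -WO in Ophi.
    have [_ [[x _ <-] Wx]] :=
      set_mem (valP phi) W (open_nbhs_nbhs (conj oW Ophi)).
    by exists (ext_map hewitt x); split; [rewrite -WO; exact: Wx|exists x].
  exists _, (set_val : hewitt -> _); split; first split.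
  + exact: val_inj.
  + exact: continuous_set_val.
  + move=> _ [W oW <-]; exists W => //; apply/seteqP.
    by split=> [_ [p Wp <-]|_ [/[swap] -[p _ <-]]]; [split|exists p].
  + suff -> : range (set_val : hewitt -> _) = closure (range cont_eval).
      exact: closed_closure.
    apply/seteqP; split=> [_ [p _ <-]|phi cphi]; first exact: set_mem (valP p).
    by exists (exist _ phi (mem_set cphi)).
- move=> f fc; pose fL : [set f : X -> R | continuous f] := exist _ f (mem_set fc).
  exists (fun phi : hewitt => set_val phi fL) => // phi.
  apply: (@continuous_comp _ _ _ (set_val : hewitt -> _) (fun phi => phi fL)).
    exact: continuous_set_val.
  exact: eval_ptws_continuous.
- move=> B [_ _ dB] /simultaneous_extension[Phi Phic PhiE].
  have PhiX : Phi \o ext_map B = cont_eval.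
    by apply/funext => x; apply/funext => f; exact: PhiE.
  have Phi_cl b : closure (range cont_eval) (Phi b).
    by rewrite -PhiX; exact: dense_range_closure.
  exists (fun b => exist _ (Phi b) (mem_set (Phi_cl b)) : hewitt).
    exact: continuous_to_set_type.
  by move=> x; apply: val_inj; apply/funext => f; exact: PhiE.
Qed.

End Extensions.

Theorem theorem48 (R : realType) (X : topologicalType) (hX : metrizable R X) :
  (exists A : extension X, hewitt_nachbin R A) /\
  (forall A : extension X,
     hewitt_nachbin R A <-> is_supremum R (samuel_family R X) A).
Proof.
split; first by exists (@hewitt R X); exact: hewitt_nachbin_hewitt.
have ubE B : realcompactification R B ->
    extends_continuous R B <-> forall S, samuel_family R X S -> ext_le S B.
  by case=> _ _; exact: extends_continuousE.
move=> A; split=> -[rA extA minA]; split=> //.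
- exact/ubE.
- by move=> B rB ubB; apply: minA => //; exact/ubE.
- exact/ubE.
- by move=> B rB extB; apply: minA => //; exact/ubE.
Qed.
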